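(* Let $\Phi:\mathbb{R}^n\to\mathbb{R}$ be a (possibly nonsmooth) function attaining its minimum $\Phi^\star$, and suppose $\Phi$ has the KL property with parameters $\theta\in\,]0,1]$ and $C>0$: $$\operatorname{dist}(0,\partial\Phi(x))\ge\frac1C\left(\Phi(x)-\Phi^\star\right)^{1-\theta}\qquad\text{for all }x\notin\operatorname{argmin}\Phi .$$ Suppose that a non-negative sequence $(a_k)_{k\ge0}$ and an $\mathbb{R}^n$-valued sequence $(x_k)_{k\ge0}$ satisfy $$\Phi(x_{k+1})\le\Phi(x_k)-a_k\operatorname{dist}^2(0,\partial\Phi(x_{k+1}))\quad\text{for all }k,\qquad\text{and}\qquad\sum_{k=1}^\infty a_k=+\infty .$$ Then $\Phi(x_k)\to\Phi^\star$, and there are positive constants $C_l,C_e$ such that: - if $\theta\in\,]0,0.5[$, then $\Phi(x_{k+1})-\Phi^\star=\mathcal{O}\left(\left(\sum_{\ell=0}^k\min\{a_\ell,C_l\}\right)^{-\frac{1}{1-2\theta}}\right)$; - if $\theta\in[0.5,1[$, then $\Phi(x_{k+1})-\Phi^\star=\mathcal{O}\left(\exp\left(-\frac{1}{2C^2}\sum_{\ell=0}^k\min\{a_\ell,C_e\}\right)\right)$; - if $\theta=1$, then $\Phi(x_{k+1})-\Phi^\star=0$ for all $k\ge K:=\inf\left\{k:\sum_{\ell=0}^k a_\ell>C^2(\Phi(x_0)-\Phi^\star)\right\}$. Consequently, with $s_k=\sum_{\ell\le k}\min(a_\ell,2C^2)$, $\;C'=\liminf_k s_k/k^{1-d}$ and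 $C''=\liminf_k s_k/\log(k)$, the following rates hold for $\Phi(x_k)-\Phi^\star$: (a) if $a_k\ge a>0$ for all $k$: $\mathcal{O}\left(k^{-\left(1+\frac{2\theta}{1-2\theta}\right)}\right)$ for $\theta\in\,]0,0.5[$; $\;\mathcal{O}\left(\left[\frac{C^2}{C^2+a}\right]^k\right)$ for $\theta\in[0.5,1[$; finite convergence for $\theta=1$; (b) if $a_k\geq 0$ and $a_k=\Omega(1/k^d)$ with $d\in\,]0,1[$: $\mathcal{O}\left(k^{-\left(1+\frac{2\theta-d}{1-2\theta}\right)}\right)$ for $\theta\in\,]0,0.5[$; $\;\mathcal{O}\left(\exp\left(-\frac{C'}{2C^2}k^{1-d}\right)\right)$ for $\theta\in[0.5,1[$; finite convergence for $\theta=1$; (c) if $a_k\geq 0$ and $a_k=\Omega(1/k)$: $\mathcal{O}\left(\log(k)^{-\frac{1}{1-2\theta}}\right)$ for $\theta\in\,]0,0.5[$; $\;\mathcal{O}\left(k^{-\frac{C''}{2C^2}}\right)$ for $\theta\in[0.5,1[$; finite convergence for $\theta=1$.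
   Context: $\partial\Phi(x)$ denotes the limiting (Fréchet) subdifferential: the set of limits of $v_j$ where $v_j$ is a Fréchet subgradient of $\Phi$ at $z_j$, $z_j\to x$, $\Phi(z_j)\to\Phi(x)$; it coincides with the convex subdifferential when $\Phi$ is convex. $\operatorname{dist}(0,S)=\inf_{s\in S}\|s\|$ (with $\operatorname{dist}(0,\emptyset)=+\infty$ and $0\cdot(+\infty)=0$), $\|\cdot\|$ the Euclidean norm. $a_k=\Omega(b_k)$ means that there exist $a>0$ and $K$ such that $a_k\ge a\,b_k$ for all $k\ge K$. ''Finite convergence'' means $\Phi(x_k)=\Phi^\star$ for all sufficiently large $k$. If $C'$ (resp. $C''$) equals $+\infty$, the corresponding bound is understood as holding with $C'$ (resp. $C''$) replaced by any positive real number. *)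

(* Defs.v *)
From mathcomp Require Export all_boot all_order all_algebra.
From mathcomp Require Export all_classical all_reals all_analysis.

Set Implicit Arguments.
Unset Strict Implicit.
Unset Printing Implicit Defensive.

Export Order.TTheory GRing.Theory Num.Theory.
Export numFieldNormedType.Exports.

Local Open Scope classical_set_scope.
Local Open Scope ring_scope.

(* The library norm on matrices is the max norm, so the Euclidean structure of
   R^n is defined here; both norms induce the library topology on 'rV[R]_n. *)
Definition dot (R : realType) (n : nat) (u v : 'rV[R]_n) : R :=
  \sum_(i < n) u 0 i * v 0 i.

Definition enorm (R : realType) (n : nat) (v : 'rV[R]_n) : R :=
  Num.sqrt (dot v v).

Definition is_min_value (R : realType) (n : nat) (Phi : 'rV[R]_n -> R)
    (m : R) : Prop :=
  (exists x, Phi x = m) /\ (forall x, m <= Phi x).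

Definition argmin (R : realType) (n : nat) (Phi : 'rV[R]_n -> R) :
    set 'rV[R]_n :=
  [set x | forall y, Phi x <= Phi y].

(* Phi y >= Phi z + <v, y - z> + o(|y - z|) as y --> z. *)
Definition frechet_subgradient (R : realType) (n : nat) (Phi : 'rV[R]_n -> R)
    (z v : 'rV[R]_n) : Prop :=
  forall eps : R, 0 < eps ->
    \forall y \near z, Phi z + dot v (y - z) - eps * enorm (y - z) <= Phi y.

Definition limiting_subdiff (R : realType) (n : nat) (Phi : 'rV[R]_n -> R)
    (x : 'rV[R]_n) : set 'rV[R]_n :=
  [set v | exists z w : nat -> 'rV[R]_n,
     [/\ forall j, frechet_subgradient Phi (z j) (w j),
         z j @[j --> \oo] --> x,
         Phi (z j) @[j --> \oo] --> Phi x
       & w j @[j --> \oo] --> v]].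

(* Equal to +oo on the empty set, by [ereal_inf0]. *)
Definition dist0 (R : realType) (n : nat) (S : set 'rV[R]_n) : \bar R :=
  ereal_inf [set (enorm s)%:E | s in S].

Definition KL_property (R : realType) (n : nat) (Phi : 'rV[R]_n -> R)
    (Phimin theta C : R) : Prop :=
  forall x, ~ argmin Phi x ->
    ((C^-1 * (Phi x - Phimin) `^ (1 - theta))%:E
       <= dist0 (limiting_subdiff Phi x))%E.

Definition capped_sum (R : realType) (a : nat -> R) (c : R) (k : nat) : R :=
  \sum_(l < k.+1) Num.min (a l) c.

(* The library's =Omega_ compares norms; this compares signed values. *)
Definition seq_Omega (R : realType) (a b : nat -> R) : Prop :=
  exists c : R, exists K : nat,
    0 < c /\ (forall k, (K <= k)%N -> c * b k <= a k).

Definition first_index (P : nat -> Prop) (K : nat) : Prop :=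
  P K /\ (forall k, P k -> (K <= k)%N).

Definition finite_convergence (R : realType) (u : nat -> R) (l : R) : Prop :=
  exists N : nat, forall k, (N <= k)%N -> u k = l.

(* A bound involving an extended-real constant L: when L = +oo, it is required
   for every positive real in place of L. *)
Definition bound_with_constant (R : realType) (L : \bar R) (B : R -> Prop) :
    Prop :=
  match L with
  | c%:E => B c
  | +oo%E => forall c : R, 0 < c -> B c
  | -oo%E => False
  end.

(* Main.v *)
Require Import Defs.
From mathcomp Require Import ring lra zify.

(** Everything happens on the gaps [r k = Phi (x k) - Phimin]. Inserting the KL
    lower bound on the distance to the subdifferential into the descent
    inequality yields the scalar recursion [kl_decrease]: the sequence [r] is
    nonincreasing and, as long as [r k.+1 > 0],
      [r k - r k.+1 >= (a k / C ^+ 2) * r k.+1 `^ (2 - 2 * theta)].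
    If [r] stayed above some [e > 0], each step would cost a fixed multiple of
    [a k], which the divergence of the series forbids; hence [r] tends to 0.

    - For [theta = 1] each step costs [a k / C ^+ 2] while [r] is positive, so
      the gap is exhausted once the partial sums exceed [C ^+ 2 * r 0]
      ([kl_decrease_finite]).
    - For [theta >= 1/2], once [r <= 1] the power [2 - 2 * theta <= 1] may be
      replaced by 1, and [r k.+1 * (1 + a k / C ^+ 2) <= r k]
      ([kl_decrease_ratio]). Bounding [1 + t] below by an exponential for
      [0 <= t <= 2], which is where the cap [2 * C ^+ 2] comes from, gives
      exponential decay in the capped sums ([kl_decrease_exp]).
    - For [theta < 1/2], with [q = 1 - 2 * theta], the quantity [r k `^ (- q)]
      grows at each step by at least a multiple of the capped step size
      ([kl_decrease_pow_step]), so it dominates the capped sum.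

    The rates in terms of [k] follow from lower bounds of the capped sums. The
    delicate ones are those whose exponent is the exact value [L] of
    a lower limit of [s k / g k]: the definition of the lower limit only gives
    [s k >= (L - e) * g k] eventually. The loss is absorbed because
    [1 + t >= expR (kappa * t / 2)] for [0 <= t <= 2] with [kappa = ln 3], and
    [ln 3 > 1]: decay is in fact faster than [expR (- s k / (2 * C ^+ 2))] by
    the factor [kappa] in the exponent ([exp_rate_liminf]). *)

Set Implicit Arguments.
Unset Strict Implicit.
Unset Printing Implicit Defensive.

Local Open Scope classical_set_scope.
Local Open Scope ring_scope.

(** * Elementary inequalities *)

(** Equivalent to [e < 3], which follows from [expR (- 1/6) >= 1 - 1/6] and
    [(6 / 5) ^+ 6 < 3]. *)
Lemma ln3_gt1 (R : realType) : 1 < ln 3 :> R.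
Proof.
have h : (5 / 6 : R) <= expR (- 6^-1) by have := expR_ge1Dx (- 6^-1 : R); lra.
have h6 : (5 / 6 : R) ^+ 6 <= expR (- 1).
  have -> : -1 = 6%:R * (- 6^-1) :> R by lra.
  by rewrite expRM_natl; apply: lerXn2r; rewrite ?nnegrE ?expR_ge0//; lra.
have e3 : expR 1 < 3 :> R.
  have := expRxMexpNx_1 (1 : R); have := expR_gt0 (1 : R).
  move: h6; set u := expR (- 1); set v := expR 1; move=> h6 v0 uv.
  have : v * (5 / 6) ^+ 6 <= v * u by rewrite ler_pM2l.
  by rewrite uv; lra.
by rewrite -ltr_expR lnK ?posrE.
Qed.

(** The chord of [expR] between 0 and [ln 3] lies above the graph. The constant
    [ln 3] is the largest for which the bound reaches [t = 2], and its being
    greater than 1 is what makes the exact constants of the rates attainable. *)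
Lemma expR_ln3_le (R : realType) (t : R) :
  0 <= t <= 2 -> expR (ln 3 / 2 * t) <= 1 + t.
Proof.
move=> /andP[t0 t2].
have s01 : 0 <= t / 2 <= 1 by lra.
have s_itv : Itv.spec (Itv.num_sem (R:=R)) (Itv.Real `[0%Z, 1%Z]) (t / 2).
  by rewrite /Itv.spec /=; rewrite /Itv.num_sem/= in_itv/= s01 ger0_real//; lra.
have := convex_expR (Itv.mk s_itv) (ln 3 : R) 0.
rewrite !convRE/= expR0 lnK ?posrE// mulr0 addr0.
rewrite (_ : _ / 2 * t = t / 2 * ln 3); last by ring.
by rewrite /unstable.onem; lra.
Qed.

Lemma le_powRN (R : realType) (x y p : R) :
  0 < x -> x <= y -> 0 <= p -> y `^ (- p) <= x `^ (- p).
Proof.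
move=> x0 xy p0; have y0 := lt_le_trans x0 xy.
by rewrite !powRN lef_pV2 ?posrE ?powR_gt0// ge0_ler_powR ?nnegrE// ltW.
Qed.

Lemma le_powR_inv (R : realType) (x y p : R) :
  0 < p -> 0 < x -> 0 < y -> y <= x `^ (- p) -> x <= y `^ (- p^-1).
Proof.
move=> p0 x0 y0 xy; rewrite -[leLHS](powRr1 (ltW x0)).
have -> : 1 = - p * - p^-1 by rewrite mulrNN divff// gt_eqF.
by rewrite powRrM; apply: le_powRN => //; rewrite invr_ge0 ltW.
Qed.

Lemma sum_le_telescope (R : realType) (u b : nat -> R) (k : nat) :
  (forall l, (l < k)%N -> b l <= u l.+1 - u l) ->
  \sum_(l < k) b l <= u k - u 0%N.
Proof.
move=> bu; rewrite -(telescope_sumr u (leq0n k)) big_mkord.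
by apply: ler_sum => l _; apply: bu.
Qed.

(** A discrete Gronwall inequality: the weights [W] may grow by the factor by
    which [r] is guaranteed to shrink. *)
Lemma weighted_decay (R : realType) (r m W : nat -> R) (K : nat) :
  (forall k, 0 <= r k) -> (forall k, 0 <= W k) ->
  (forall k, (K <= k)%N -> r k.+1 * m k <= r k) ->
  (forall k, (K <= k)%N -> W k.+1 <= m k * W k) ->
  forall k, (K <= k)%N -> r k * W k <= r K * W K.
Proof.
move=> r0 W0 rm Wm; elim=> [|k IH]; first by rewrite leqn0 => /eqP ->.
rewrite leq_eqVlt => /orP[/eqP <-//|]; rewrite ltnS => Kk.
apply: le_trans (IH Kk); apply: le_trans (ler_wpM2r (W0 k) (rm k Kk)).
by rewrite -mulrA ler_wpM2l// Wm.
Qed.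

Lemma eqO_eventually (R : realType) (f g : nat -> R) (M : R) (N : nat) :
  (forall k, 0 <= f k) -> (forall k, (N <= k)%N -> f k <= M * g k) ->
  f =O_\oo g.
Proof.
move=> f0 fg; apply/eqO_exP; exists (`|M| + 1); first by rewrite ltr_wpDl.
exists N => // k /= Nk; rewrite ger0_norm//.
apply: le_trans (fg k Nk) _; apply: le_trans (ler_norm _) _.
by rewrite normrM; apply: ler_wpM2r => //; rewrite lerDl ler01.
Qed.

Lemma eqO_eventuallyS (R : realType) (f g : nat -> R) (M : R) (N : nat) :
  (forall k, 0 <= f k) -> (forall k, (N <= k)%N -> f k.+1 <= M * g k.+1) ->
  f =O_\oo g.
Proof. by move=> f0 fg; apply: (@eqO_eventually _ _ _ M N.+1) => // -[]. Qed.

Lemma partial_sums_unbounded (R : realType) (a : nat -> R) :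
  (forall k, 0 <= a k) -> (\sum_(1 <= k <oo) (a k)%:E = +oo)%E ->
  forall A : R, exists k, A < \sum_(l < k.+1) a l.
Proof.
move=> a0 ainf A.
have : (\sum_(1 <= l < k) (a l)%:E)%E @[k --> \oo]
    --> (\sum_(1 <= l <oo) (a l)%:E)%E.
  by apply: is_cvg_nneseries => l _ _; rewrite lee_fin.
rewrite ainf => /cvgeyPge/(_ (A + 1))[N _ /(_ N (leqnn N))] /=.
rewrite sumEFin lee_fin => AN; exists N.
apply: (@lt_le_trans _ _ (\sum_(1 <= l < N.+1) a l)).
  case: (posnP N) AN => [->|N0]; first by rewrite !big_geq//; lra.
  by rewrite big_nat_recr//= => AN; have := a0 N; lra.
by rewrite -(big_mkord xpredT a) (@big_ltn _ _ _ 0%N)// lerDr.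
Qed.

(** * The scalar recursion *)

(** The trace of the KL property and of the descent condition on the gaps [r].
    The decrease is only required where [r k.+1 > 0], since the KL inequality
    says nothing at minimizers; for [theta = 1] the condition could fail there,
    as [0 `^ 0 = 1]. *)
Definition kl_decrease (R : realType) (theta C : R) (a r : nat -> R) : Prop :=
  [/\ forall k, 0 <= a k, forall k, 0 <= r k, forall k, r k.+1 <= r k
    & forall k, 0 < r k.+1 ->
        a k * (C^-1 * r k.+1 `^ (1 - theta)) ^+ 2 <= r k - r k.+1].

(** The distance is an extended real. If it is infinite, then finiteness of
    [Phi] forces [a k = 0], and the convention [0 * +oo = 0] leaves the plain
    monotonicity; otherwise the lower bound can be squared and multiplied
    by [a k]. *)
Lemma kl_decrease_gap (R : realType) (n : nat) (Phi : 'rV[R]_n -> R)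
    (Phimin theta C : R) (a : nat -> R) (x : nat -> 'rV[R]_n) :
  is_min_value Phi Phimin -> 0 < C -> KL_property Phi Phimin theta C ->
  (forall k, 0 <= a k) ->
  (forall k,
      ((Phi (x k.+1))%:E <=
         (Phi (x k))%:E
           - (a k)%:E * dist0 (limiting_subdiff Phi (x k.+1)) ^+ 2)%E) ->
  kl_decrease theta C a (fun k => Phi (x k) - Phimin).
Proof.
move=> [[xm Pxm] Pmin] C0 KL a0 dec.
have step k (e : R) : 0 <= e ->
    (e%:E <= dist0 (limiting_subdiff Phi (x k.+1)))%E ->
    a k * e ^+ 2 <= Phi (x k) - Phi (x k.+1).
  move=> e0 ed; move: (dec k) ed.
  case: (dist0 _) => [d| |] //.
    rewrite -EFin_expe -EFinM -EFinB !lee_fin => h ed.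
    have : a k * e ^+ 2 <= a k * d ^+ 2.
      apply: ler_wpM2l => //; apply: lerXn2r; rewrite ?nnegrE//.
      exact: le_trans e0 ed.
    by lra.
  have := a0 k; rewrite le_eqVlt => /orP[/eqP <-|ak0].
    by rewrite mul0e sube0 lee_fin => h _; lra.
  by rewrite expe2 mulyy gt0_muley ?lte_fin.
split=> // [k|k|k]; first by rewrite subr_ge0.
  rewrite lerB//.
  have := step k 0 (lexx _); rewrite expr0n/= mulr0 subr_ge0; apply.
  by apply: le_ereal_inf_tmp => _ [v _ <-]; rewrite lee_fin sqrtr_ge0.
rewrite subr_gt0 => rk.
rewrite [leRHS](_ : _ = Phi (x k) - Phi (x k.+1)); last by ring.
apply: step; first by rewrite mulr_ge0 ?powR_ge0// invr_ge0 ltW.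
by apply: KL => /(_ xm); rewrite Pxm leNgt rk.
Qed.

Section KL_decrease.
Variables (R : realType) (theta C : R) (a r : nat -> R).
Hypotheses (C_gt0 : 0 < C) (kl : kl_decrease theta C a r).

Lemma kl_decrease_homo : {homo r : k l / (k <= l)%N >-> l <= k}.
Proof.
by case: kl => _ _ rS _; apply: homo_leq => // y x z xy /le_trans; apply.
Qed.

(** While [r >= e], every step costs at least [w * a k] for the constant [w]
    below, so the partial sums of [a] would be bounded by [r 0 / w]. *)
Lemma kl_decrease_small :
  (forall A, exists k, A < \sum_(l < k.+1) a l) -> theta <= 1 ->
  forall e, 0 < e -> exists N, forall k, (N <= k)%N -> r k < e.
Proof.
case: kl => a0 r0 rS klk unbounded th1 e e0.
have [[N rN]|nr] := pselect (exists N, r N < e).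
  by exists N => k Nk; apply: le_lt_trans rN; apply: kl_decrease_homo.
exfalso.
have re k : e <= r k by rewrite leNgt; apply/negP => rk; apply: nr; exists k.
pose w := (C^-1 * e `^ (1 - theta)) ^+ 2.
have w0 : 0 < w by rewrite exprn_gt0// mulr_gt0 ?invr_gt0 ?powR_gt0.
have [k] := unbounded (r 0%N / w).
rewrite ltNge ler_pdivlMr// mulr_suml => /negP; apply.
suff : \sum_(l < k.+1) (a l * w) <= - r k.+1 - - r 0%N.
  by rewrite opprK => /le_trans; apply; rewrite gerDr oppr_le0.
apply: (@sum_le_telescope _ (fun l => - r l) (fun l => a l * w)) => l _.
apply: le_trans (_ : _ <= a l * (C^-1 * r l.+1 `^ (1 - theta)) ^+ 2) _.
  apply: ler_wpM2l => //; apply: lerXn2r;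
    rewrite ?nnegrE ?mulr_ge0 ?powR_ge0 ?invr_ge0 ?(ltW C_gt0)//.
  apply: ler_wpM2l; first by rewrite invr_ge0 ltW.
  by apply: ge0_ler_powR; rewrite ?nnegrE ?subr_ge0 ?(ltW e0).
by rewrite opprK [leRHS]addrC; apply: klk; apply: lt_le_trans e0 _.
Qed.

(** If [r K.+1] were positive, so would be all earlier gaps, and each step up
    to [K] would have cost [a l / C ^+ 2]. *)
Lemma kl_decrease_finite K : theta = 1 ->
  C ^+ 2 * r 0%N < \sum_(l < K.+1) a l -> r K.+1 = 0.
Proof.
case: kl => a0 r0 rS klk th1 CK; apply/eqP; rewrite eq_le r0 andbT leNgt.
apply/negP => rK.
have : \sum_(l < K.+1) (a l * (C^-1 * C^-1)) <= - r K.+1 - - r 0%N.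
  apply: (@sum_le_telescope _ (fun l => - r l) (fun l => a l * _)) => l lK.
  rewrite opprK [leRHS]addrC.
  have := klk l (lt_le_trans rK (kl_decrease_homo lK)).
  by rewrite th1 subrr powRr0 mulr1 expr2.
rewrite -mulr_suml opprK => h.
have : \sum_(l < K.+1) a l <= C ^+ 2 * r 0%N; last by rewrite leNgt CK.
rewrite mulrC -ler_pdivrMr ?exprn_gt0// expr2 invfM.
by apply: le_trans h _; rewrite gerDr oppr_le0.
Qed.

(** Once [r <= 1], raising to the power [2 * (1 - theta) <= 1] does not
    decrease, so the recursion is at least linear. *)
Lemma kl_decrease_ratio :
  (forall e, 0 < e -> exists N, forall k, (N <= k)%N -> r k < e) ->
  2^-1 <= theta -> theta <= 1 ->
  exists N, forall k, (N <= k)%N -> r k.+1 * (1 + a k / C ^+ 2) <= r k.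
Proof.
case: kl => a0 r0 rS klk small th2 th1.
have [N rN] := small 1 ltr01; exists N => k Nk.
have := r0 k.+1; rewrite le_eqVlt => /orP[/eqP <-|rk0]; first by rewrite mul0r.
have r1 : r k.+1 < 1 by apply: rN; lia.
have : r k.+1 <= (r k.+1 `^ (1 - theta)) ^+ 2.
  rewrite -powR_mulrn ?powR_ge0// -powRrM; apply: ger1_powR; last by lra.
  by rewrite rk0 ltW.
have aC : 0 <= a k / C ^+ 2 by rewrite divr_ge0// exprn_ge0// ltW.
move=> /(ler_wpM2l aC) h.
have := klk k rk0; rewrite exprMn exprVn; set u := _ ^+ 2 in h *.
by rewrite mulrA => {}klk; lra.
Qed.

End KL_decrease.

(** * Decay in terms of the capped sums *)

Lemma capped_sum_ge0 (R : realType) (a : nat -> R) (c : R) (k : nat) :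
  (forall k, 0 <= a k) -> 0 <= c -> 0 <= capped_sum a c k.
Proof. by move=> a0 c0; apply: sumr_ge0 => l _; rewrite le_min a0. Qed.

Lemma capped_sumS (R : realType) (a : nat -> R) (c : R) (k : nat) :
  capped_sum a c k.+1 <= capped_sum a c k + c.
Proof. by rewrite /capped_sum big_ord_recr lerD2l ge_min lexx orbT. Qed.

Lemma capped_sum_gt0 (R : realType) (a : nat -> R) (c : R) (k k' : nat) :
  (forall l, 0 <= a l) -> 0 < c -> 0 < \sum_(l < k.+1) a l -> (k <= k')%N ->
  0 < capped_sum a c k'.
Proof.
move=> a0 c0 ak kk'.
have [l al] : exists l : 'I_k.+1, 0 < a l.
  apply/not_existsP => an; move: ak; rewrite big1 ?ltxx// => l _.
  by apply/eqP; rewrite eq_le a0 andbT leNgt; apply/negP/an.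
have lk' : (l < k'.+1)%N by apply: leq_trans (ltn_ord l) _.
rewrite /capped_sum (bigD1 (Ordinal lk'))//= ltr_pwDl ?lt_min ?al//.
by apply: sumr_ge0 => j _; rewrite le_min a0 ltW.
Qed.

Section Capped_decay.
Variables (R : realType) (theta C : R) (a r : nat -> R).
Hypotheses (C_gt0 : 0 < C) (kl : kl_decrease theta C a r).

(** The cap keeps [t = min (a k) (2 * C ^+ 2) / C ^+ 2] between 0 and 2, where
    [1 + t] dominates [expR (ln 3 / 2 * t)]; multiplying these factors up gives
    the exponential of the capped sum. *)
Lemma kl_decrease_exp N :
  (forall k, (N <= k)%N -> r k.+1 * (1 + a k / C ^+ 2) <= r k) ->
  exists2 M, 0 <= M & forall k, (N <= k)%N ->
    r k.+1 <= M * expR (- (ln 3 / (2 * C ^+ 2) * capped_sum a (2 * C ^+ 2) k)).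
Proof.
case: kl => a0 r0 _ _ rm.
pose w := ln 3 / (2 * C ^+ 2).
pose W k := expR (w * \sum_(l < k) Num.min (a l) (2 * C ^+ 2)).
have C2 : 0 < C ^+ 2 by rewrite exprn_gt0.
exists (r N * W N); first by rewrite mulr_ge0 ?expR_ge0.
move=> k Nk; rewrite expRN ler_pdivlMr ?expR_gt0//.
have := @weighted_decay _ r _ W N r0 (fun k => expR_ge0 _) rm _ k.+1 (leqW Nk).
apply=> l _; rewrite /W big_ord_recr/= mulrDr expRD mulrC.
apply: ler_wpM2r; first exact: expR_ge0.
set m := Num.min _ _.
have -> : w * m = ln 3 / 2 * (m / C ^+ 2) by rewrite /w; field; rewrite gt_eqF.
apply: le_trans (expR_ln3_le _) _.
  rewrite divr_ge0 ?(ltW C2)//=; last by rewrite le_min a0/=; lra.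
  by rewrite ler_pdivrMr// ge_min lexx orbT.
by rewrite lerD2l ler_pM2r ?invr_gt0// ge_min lexx.
Qed.

Let q := 1 - 2 * theta.
(* The cap ensures [cap / C ^+ 2 * r k.+1 `^ q <= 2] for all [k], because
   [r k.+1 <= r 0]; the summand 1 keeps the denominator positive when
   [r 0 = 0]. *)
Let cap := 2 * C ^+ 2 / (1 + r 0%N `^ q).

(** The recursion reads [r k.+1 * (1 + t) <= r k] with
    [t = m / C ^+ 2 * r k.+1 `^ q], [m] the capped step size. Taking the
    power [- q], where [(1 + t) `^ q >= 1 + q * t / 2] for [0 <= t <= 2], makes
    the factor [r k.+1 `^ q] cancel, so that the increment does not depend
    on [r]. *)
Lemma kl_decrease_pow_step k : 0 < theta -> theta < 2^-1 -> 0 < r k.+1 ->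
  q / (4 * C ^+ 2) * Num.min (a k) cap <= r k.+1 `^ (- q) - r k `^ (- q).
Proof.
case: (kl) => a0 r0 rS klk th0 th2 rk0.
have q0 : 0 < q by rewrite /q; lra.
have q1 : q <= 1 by rewrite /q; lra.
have C2 : 0 < C ^+ 2 by rewrite exprn_gt0.
set m := Num.min _ _; set u := r k.+1 `^ q; set v := r k `^ q.
have u0 : 0 < u by rewrite powR_gt0.
have cap0 : 0 < cap by rewrite /cap divr_gt0 ?mulr_gt0// ltr_wpDr ?powR_ge0.
have m0 : 0 <= m by rewrite le_min a0 ltW.
pose t := m / C ^+ 2 * u.
have t0 : 0 <= t by rewrite mulr_ge0 ?divr_ge0 ?(ltW C2) ?(ltW u0).
have t2 : t <= 2.
  have mc : m <= cap by rewrite ge_min lexx orbT.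
  have uu : u <= 1 + r 0%N `^ q.
    rewrite ler_wpDl// ge0_ler_powR ?nnegrE ?(ltW q0)//.
    exact: (kl_decrease_homo kl).
  rewrite /t mulrAC ler_pdivrMr//.
  apply: le_trans (ler_pM m0 (ltW u0) mc uu) _.
  by rewrite /cap divfK// gt_eqF// ltr_wpDr ?powR_ge0.
have rt : r k.+1 * (1 + t) <= r k.
  have := klk k rk0; rewrite exprMn exprVn.
  rewrite -[(_ `^ _) ^+ 2]powR_mulrn ?powR_ge0// -powRrM.
  rewrite (_ : (1 - theta) * 2%:R = 1 + q); last by rewrite /q; ring.
  rewrite powRD ?(gt_eqF rk0) ?implybT// powRr1 ?(ltW rk0)// -/u => {}klk.
  have : m * ((C ^+ 2)^-1 * (r k.+1 * u)) <= a k * ((C ^+ 2)^-1 * (r k.+1 * u)).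
    apply: ler_wpM2r; last by rewrite ge_min lexx.
    by rewrite !mulr_ge0 ?invr_ge0 ?(ltW C2) ?(ltW u0) ?(ltW rk0).
  by rewrite /t; lra.
pose s := t / 2 * q.
have s0 : 0 <= s by rewrite mulr_ge0 ?divr_ge0 ?(ltW q0).
have s1 : s <= 1 by rewrite -[1]mulr1 ler_pM ?(ltW q0)//; lra.
have uv : u * (1 + s) <= v.
  apply: le_trans (_ : (r k.+1 * (1 + t)) `^ q <= _); last first.
    by rewrite ge0_ler_powR ?nnegrE ?mulr_ge0 ?(ltW q0) ?(ltW rk0) ?addr_ge0.
  rewrite powRM ?(ltW rk0) ?addr_ge0// ler_wpM2l ?(ltW u0)//.
  apply: le_trans (expR_ge1Dx _) _; rewrite expRM.
  rewrite ge0_ler_powR ?nnegrE ?expR_ge0 ?(ltW q0) ?addr_ge0//.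
  apply: le_trans (expR_ln3_le (_ : 0 <= t <= 2)); last by rewrite t0.
  by rewrite ler_expR; have := ln3_gt1 R; nra.
have -> : q / (4 * C ^+ 2) * m = u^-1 * (s / 2).
  by rewrite /s /t; field; rewrite !gt_eqF.
rewrite !powRN -/u -/v lerBrDr -lerBrDl.
have us0 : 0 < u * (1 + s) by rewrite mulr_gt0// ltr_wpDr.
apply: le_trans (_ : (u * (1 + s))^-1 <= _).
  by rewrite lef_pV2 ?posrE//; apply: lt_le_trans us0 uv.
rewrite -[X in _ <= X - _]mulr1 -mulrBr invfM ler_pM2l ?invr_gt0//.
have s1p : 0 < 1 + s by rewrite ltr_wpDr.
by rewrite -div1r ler_pdivrMr//; nra.
Qed.

Lemma kl_decrease_pow : 0 < theta -> theta < 2^-1 ->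
  exists2 c, 0 < c & forall k, 0 < capped_sum a cap k ->
    r k.+1 <= (c * capped_sum a cap k) `^ (- q^-1).
Proof.
move=> th0 th2; case: (kl) => a0 r0 rS klk.
have q0 : 0 < q by rewrite /q; lra.
exists (q / (4 * C ^+ 2)); first by rewrite divr_gt0// mulr_gt0// exprn_gt0.
move=> k sk; have := r0 k.+1; rewrite le_eqVlt => /orP[/eqP <-|rk0].
  exact: powR_ge0.
apply: le_powR_inv => //.
  by rewrite mulr_gt0// divr_gt0// mulr_gt0// exprn_gt0.
rewrite /capped_sum mulr_sumr.
apply: le_trans (_ : _ <= r k.+1 `^ (- q) - r 0%N `^ (- q)) _; last first.
  by rewrite gerDl oppr_le0 powR_ge0.
apply: (@sum_le_telescope _ (fun l => r l `^ (- q))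
  (fun l => _ * Num.min (a l) cap)).
move=> l lk; apply: kl_decrease_pow_step => //.
by apply: lt_le_trans rk0 (kl_decrease_homo kl _).
Qed.

Lemma kl_decrease_pow_rate c N (g : nat -> R) : 0 < theta -> theta < 2^-1 ->
  0 < c -> (forall k, (N <= k)%N -> 0 < g k.+1) ->
  (forall k, (N <= k)%N -> c * g k.+1 <= capped_sum a cap k) ->
  r =O_\oo (fun k => g k `^ (- q^-1)).
Proof.
move=> th0 th2 c0 g0 gs; case: (kl) => _ r0 _ _.
have [e e0 re] := kl_decrease_pow th0 th2.
have q0 : 0 < q by rewrite /q; lra.
apply: (@eqO_eventuallyS _ _ _ ((e * c) `^ (- q^-1)) N) => // k Nk.
have cg : 0 < c * g k.+1 by rewrite mulr_gt0 ?g0.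
apply: le_trans (re k (lt_le_trans cg (gs k Nk))) _.
rewrite -powRM ?mulr_ge0 ?(ltW e0) ?(ltW c0) ?(ltW (g0 k Nk))// -mulrA.
by apply: le_powRN; rewrite ?mulr_gt0 ?g0 ?ler_pM2l ?gs// invr_ge0 ltW.
Qed.

End Capped_decay.

(** * Exact constants given by lower limits *)

Lemma limn_einf_gt (R : realType) (u : nat -> \bar R) (e : \bar R) :
  (e < limn_einf u)%E -> exists N, forall k, (N <= k)%N -> (e < u k)%E.
Proof.
rewrite limn_einf_lim (cvg_lim _ (@cvg_einfs_sup _ u))// => /ereal_sup_gt.
move=> [_ [N _ <-] eN]; exists N => k Nk; apply: lt_le_trans eN _.
by apply: ereal_inf_lbound; exists k.
Qed.

Lemma limn_einf_ge0 (R : realType) (u : nat -> \bar R) :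
  (forall k, (0 <= u k)%E) -> (0 <= limn_einf u)%E.
Proof.
move=> u0; rewrite limn_einf_lim (cvg_lim _ (@cvg_einfs_sup _ u))//.
apply: le_trans (ereal_sup_ubound (_ : range (einfs u) (einfs u 0%N))) => //.
by apply: le_ereal_inf_tmp => _ [k _ <-].
Qed.

(** The surplus [kappa > 1] in the exponent pays for the difference between the
    lower limit [L] of [s / g] and the bounds that hold eventually, as
    [L / kappa < L] when [0 < L < +oo]. The hypothesis on the increments of [s]
    turns the bound on [r k.+1] by [s k] into one by [s k.+1], at the cost of a
    factor [expR kappa]. The target [h] is an arbitrary majorant so that both
    [expR (- c * g k)] and powers of [k] fit. *)
Lemma exp_rate_liminf (R : realType) (kappa b M : R) (N : nat)
    (r s g : nat -> R) (h : R -> nat -> R) :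
  1 < kappa -> 0 < b -> 0 <= M ->
  (forall k, 0 <= r k) -> (forall k, 0 <= s k) -> (forall k, 0 <= g k) ->
  (forall k, s k.+1 <= s k + b) ->
  (forall k, (N <= k)%N -> r k.+1 <= M * expR (- (kappa / b * s k))) ->
  (forall c k, expR (- (c / b) * g k.+1) <= h c k.+1) ->
  bound_with_constant (limn_einf (fun k => (s k / g k)%:E))
    (fun c => r =O_\oo h c).
Proof.
move=> k1 b0 M0 r0 s0 g0 sS rs gh.
have kp0 : 0 < kappa by lra.
have key c K : (forall k, (K <= k)%N -> c * g k <= kappa * s k) -> r =O_\oo h c.
  move=> gs.
  apply: (@eqO_eventuallyS _ _ _ (M * expR kappa) (maxn N K)) => // k.
  rewrite geq_max => /andP[Nk Kk]; apply: le_trans (rs k Nk) _.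
  rewrite -[leRHS]mulrA ler_wpM2l//.
  apply: le_trans (ler_wpM2l (expR_ge0 _) (gh c k)).
  rewrite -expRD ler_expR.
  have : c * g k.+1 <= kappa * (s k + b).
    by apply: le_trans (gs k.+1 (leqW Kk)) _; rewrite ler_pM2l.
  rewrite -(@ler_pM2r _ b^-1) ?invr_gt0// mulrDr mulrDl mulfK ?gt_eqF//.
  by rewrite mulNr !(mulrAC _ b^-1); lra.
(* Any [c] with [c / kappa] below the lower limit is admissible; for a finite
   positive lower limit [L] this includes [c = L] as [kappa > 1]. *)
have pos c : 0 < c ->
    ((c / kappa)%:E < limn_einf (fun k => (s k / g k)%:E))%E -> r =O_\oo h c.
  move=> c0 /limn_einf_gt[K sK]; apply: (key c K) => k /sK; rewrite lte_fin.
  have := g0 k; rewrite le_eqVlt => /orP[/eqP <- _|gk].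
    by rewrite mulr0 mulr_ge0// ltW.
  rewrite ltr_pdivlMr// mulrAC ltr_pdivrMr// => /ltW.
  by rewrite [leRHS]mulrC.
have : (0 <= limn_einf (fun k => (s k / g k)%:E))%E.
  by apply: limn_einf_ge0 => k; rewrite lee_fin divr_ge0.
case: (limn_einf _) pos => [c| |] pos //=; last first.
  by move=> _ c /pos; apply; rewrite ltry.
rewrite lee_fin le_eqVlt => /orP[/eqP <-|c0].
  by apply: (key _ 0%N) => k _; rewrite mul0r mulr_ge0// ltW.
by apply: pos => //; rewrite lte_fin ltr_pdivrMr// ltr_pMr.
Qed.

(** * Lower bounds of the capped sums *)

(** Since [b <= 1], capping costs only a constant factor. *)
Lemma capped_sum_Omega (R : realType) (a b : nat -> R) (cap : R) :
  (forall k, 0 <= a k) -> (forall k, (0 < k)%N -> 0 <= b k <= 1) ->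
  0 < cap -> seq_Omega a b ->
  exists c K, [/\ 0 < c, (0 < K)%N & forall k, (K <= k)%N ->
    c * \sum_(K <= l < k.+1) b l <= capped_sum a cap k].
Proof.
move=> a0 b01 cap0 [c [K0 [c0 Kab]]].
have m0 : 0 < Num.min c cap by rewrite lt_min c0.
exists (Num.min c cap), (maxn K0 1); split => // [|k Kk].
  by rewrite leq_max orbT.
rewrite /capped_sum -(big_mkord xpredT (fun l => Num.min (a l) cap)).
rewrite [leRHS](@big_cat_nat _ _ _ (maxn K0 1))//=; last exact: leqW.
rewrite mulr_sumr ler_wpDl//.
  by apply: sumr_ge0 => l _; rewrite le_min a0 ltW.
apply: ler_sum_nat => l.
rewrite geq_max => /andP[/andP[Kl l0] _].
have /andP[bl0 bl1] := b01 l l0.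
rewrite le_min; apply/andP; split.
  by apply: le_trans (Kab l Kl); rewrite ler_wpM2r// ge_min lexx.
apply: le_trans (_ : Num.min c cap <= _); last by rewrite ge_min lexx orbT.
by rewrite ler_piMr// ltW.
Qed.

(** Each of the at least [k / 2] terms is bounded below by [k `^ (- d)]. *)
Lemma power_sum_ge (R : realType) (d : R) (K k : nat) : 0 <= d ->
  (0 < K)%N -> (2 * K <= k)%N ->
  2^-1 * k%:R `^ (1 - d) <= \sum_(K <= l < k) (1 / l%:R `^ d).
Proof.
move=> d0 K0 Kk.
have k0 : 0 < k%:R :> R by rewrite ltr0n; lia.
apply: (@le_trans _ _ (\sum_(K <= l < k) (k%:R `^ d)^-1)).
  rewrite sumr_const_nat powRB ?(gt_eqF k0) ?implybT// powRr1 ?(ltW k0)//.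
  rewrite mulrA -[leRHS]mulr_natl ler_wpM2r ?invr_ge0 ?powR_ge0//.
  rewrite natrB; last by lia.
  have : (2 * K)%:R <= k%:R :> R by rewrite ler_nat.
  by rewrite natrM; lra.
apply: ler_sum_nat => l.
move=> /andP[Kl lk].
have l0 : 0 < l%:R :> R by rewrite ltr0n; lia.
rewrite div1r lef_pV2 ?posrE ?powR_gt0//.
by apply: ge0_ler_powR; rewrite ?nnegrE ?ler_nat// ltnW.
Qed.

(** [1 / l >= ln l.+1 - ln l], and [ln K] is at most half of [ln k]. *)
Lemma harmonic_sum_ge (R : realType) (K k : nat) :
  (0 < K)%N -> (K ^ 2 <= k)%N ->
  2^-1 * ln k%:R <= \sum_(K <= l < k) (1 / l%:R) :> R.
Proof.
move=> K0 Kk.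
have K0R : 0 < K%:R :> R by rewrite ltr0n.
have KleK : (K <= k)%N by apply: leq_trans Kk; rewrite -{1}(expn1 K) leq_pexp2l.
have k0R : 0 < k%:R :> R by rewrite ltr0n; lia.
have lnK2 : 2 * ln K%:R <= ln k%:R :> R.
  rewrite mulr_natl -lnXn// -natrX ler_ln ?posrE ?ler_nat//.
  by rewrite ltr0n expn_gt0 K0.
apply: (@le_trans _ _ (ln k%:R - ln K%:R)); first by lra.
rewrite -(telescope_sumr (fun l => ln l%:R) KleK).
apply: ler_sum_nat => l.
move=> /andP[Kl _].
have l0 : 0 < l%:R :> R by rewrite ltr0n; lia.
rewrite -ln_div ?posrE ?ltr0n//; last by lia.
rewrite -natr1 mulrDl divff ?gt_eqF//; apply: le_ln1Dx.
have : 0 < 1 / l%:R :> R by rewrite divr_gt0.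
by lra.
Qed.

(** * Convergence rates *)

Theorem theorem3p3 (R : realType) (n : nat) (Phi : 'rV[R]_n -> R)
    (Phimin theta C : R) (a : nat -> R) (x : nat -> 'rV[R]_n)
    (hmin : is_min_value Phi Phimin)
    (theta_gt0 : 0 < theta) (theta_le1 : theta <= 1) (C_gt0 : 0 < C)
    (hKL : KL_property Phi Phimin theta C)
    (a_ge0 : forall k, 0 <= a k)
    (hdescent : forall k,
      ((Phi (x k.+1))%:E <=
         (Phi (x k))%:E
           - (a k)%:E * dist0 (limiting_subdiff Phi (x k.+1)) ^+ 2)%E)
    (hsum : (\sum_(1 <= k <oo) (a k)%:E = +oo)%E) :
  [/\ Phi (x k) @[k --> \oo] --> Phimin,
      exists Cl Ce : R,
        [/\ 0 < Cl, 0 < Ce,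
            (theta < 2^-1 ->
              (fun k => Phi (x k.+1) - Phimin) =O_\oo
              (fun k => capped_sum a Cl k `^ (- (1 - 2 * theta)^-1))),
            (2^-1 <= theta -> theta < 1 ->
              (fun k => Phi (x k.+1) - Phimin) =O_\oo
              (fun k => expR (- (2 * C ^+ 2)^-1 * capped_sum a Ce k)))
          & (theta = 1 ->
              exists K : nat,
                first_index (fun k =>
                  C ^+ 2 * (Phi (x 0%N) - Phimin) < \sum_(l < k.+1) a l) K /\
                (forall k, (K <= k)%N -> Phi (x k.+1) - Phimin = 0))],
      (forall a0 : R, 0 < a0 -> (forall k, a0 <= a k) ->
        [/\ (theta < 2^-1 ->
              (fun k => Phi (x k) - Phimin) =O_\oo
              (fun k => k%:R `^ (- (1 + (2 * theta) / (1 - 2 * theta))))),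
            (2^-1 <= theta -> theta < 1 ->
              (fun k => Phi (x k) - Phimin) =O_\oo
              (fun k => (C ^+ 2 / (C ^+ 2 + a0)) ^+ k))
          & (theta = 1 -> finite_convergence (fun k => Phi (x k)) Phimin)]),
      (forall d : R, 0 < d -> d < 1 ->
        seq_Omega a (fun k => 1 / k%:R `^ d) ->
        [/\ (theta < 2^-1 ->
              (fun k => Phi (x k) - Phimin) =O_\oo
              (fun k => k%:R `^ (- (1 + (2 * theta - d) / (1 - 2 * theta))))),
            (2^-1 <= theta -> theta < 1 ->
              bound_with_constant
                (limn_einf (fun k =>
                  (capped_sum a (2 * C ^+ 2) k / k%:R `^ (1 - d))%:E))
                (fun C' =>
                  (fun k => Phi (x k) - Phimin) =O_\oo
                  (fun k => expR (- (C' / (2 * C ^+ 2)) * k%:R `^ (1 - d)))))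
          & (theta = 1 -> finite_convergence (fun k => Phi (x k)) Phimin)])
    & (seq_Omega a (fun k => 1 / k%:R) ->
        [/\ (theta < 2^-1 ->
              (fun k => Phi (x k) - Phimin) =O_\oo
              (fun k => ln k%:R `^ (- (1 - 2 * theta)^-1))),
            (2^-1 <= theta -> theta < 1 ->
              bound_with_constant
                (limn_einf (fun k =>
                  (capped_sum a (2 * C ^+ 2) k / ln k%:R)%:E))
                (fun C'' =>
                  (fun k => Phi (x k) - Phimin) =O_\oo
                  (fun k => k%:R `^ (- (C'' / (2 * C ^+ 2))))))
          & (theta = 1 -> finite_convergence (fun k => Phi (x k)) Phimin)])].
Proof.
pose r k := Phi (x k) - Phimin.
have kl : kl_decrease theta C a r by exact: kl_decrease_gap.
have r0 k : 0 <= r k by case: kl.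
have C2 : 0 < C ^+ 2 by rewrite exprn_gt0.
have unbounded := partial_sums_unbounded a_ge0 hsum.
have small := kl_decrease_small C_gt0 kl unbounded theta_le1.
have ratio := kl_decrease_ratio C_gt0 kl small.
pose Cl := 2 * C ^+ 2 / (1 + r 0%N `^ (1 - 2 * theta)).
pose Ce := 2 * C ^+ 2.
have Cl0 : 0 < Cl by rewrite divr_gt0 ?mulr_gt0// ltr_wpDr ?powR_ge0.
have Ce0 : 0 < Ce by rewrite mulr_gt0.
have exp_rate : 2^-1 <= theta -> exists M N, 0 <= M /\ forall k, (N <= k)%N ->
    r k.+1 <= M * expR (- (ln 3 / Ce * capped_sum a Ce k)).
  move=> th2; have [N rN] := ratio th2 theta_le1.
  have [M M0 rM] := kl_decrease_exp C_gt0 kl rN.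
  by exists M, N.
have vanish (K : nat) : theta = 1 -> C ^+ 2 * r 0%N < \sum_(l < K.+1) a l ->
    forall k, (K <= k)%N -> r k.+1 = 0.
  move=> th1 CK k Kk; apply: (kl_decrease_finite C_gt0 kl th1).
  apply: lt_le_trans CK _; rewrite -!(big_mkord xpredT a).
  by rewrite [leRHS](@big_cat_nat _ _ _ K.+1)//= lerDl sumr_ge0.
have finite : theta = 1 -> finite_convergence (fun k => Phi (x k)) Phimin.
  move=> th1; have [K CK] := unbounded (C ^+ 2 * r 0%N).
  exists K.+1 => -[//|k] Kk; apply/eqP; rewrite -subr_eq0; apply/eqP.
  exact: (vanish K th1 CK).
split.
- apply/cvgrPdist_lt => e e0; have [N rN] := small e e0.
  exists N => // k /= Nk; rewrite distrC ger0_norm ?(r0 k)//.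
  exact: rN.
- exists Cl, Ce; split=> // [th2|th2 _|th1].
  + have [e e0 re] := kl_decrease_pow C_gt0 kl theta_gt0 th2.
    have [K aK] := unbounded 0.
    apply: (@eqO_eventually _ _ _ (e `^ (- (1 - 2 * theta)^-1)) K) => [k|k Kk].
      exact: r0.
    have sk := capped_sum_gt0 a_ge0 Cl0 aK Kk.
    by rewrite -powRM ?(ltW e0) ?(ltW sk)//; apply: re.
  + have [M [N [M0 rM]]] := exp_rate th2.
    apply: (@eqO_eventually _ _ _ M N) => [k|k Nk]; first exact: r0.
    apply: le_trans (rM k Nk) _; rewrite ler_wpM2l// ler_expR -mulNr.
    rewrite ler_wpM2r ?(capped_sum_ge0 _ _ (ltW Ce0))//.
    by rewrite lerN2 ler_peMl ?invr_ge0 ?(ltW Ce0) ?(ltW (ln3_gt1 R)).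
  + pose P k := C ^+ 2 * (Phi (x 0%N) - Phimin) < \sum_(l < k.+1) a l.
    have exP : exists k, P k by exact: unbounded.
    exists (ex_minn exP); case: ex_minnP => K PK Kmin.
    by split; [split=> // k; exact: Kmin|exact: vanish].
- move=> c c0 ca; split=> // [th2|th2 th1].
  + have -> : 1 + 2 * theta / (1 - 2 * theta) = (1 - 2 * theta)^-1.
      by field; lra.
    apply: (@kl_decrease_pow_rate _ _ _ _ _ C_gt0 kl (Num.min c Cl) 0%N) => //.
      by rewrite lt_min c0.
    move=> k _; rewrite mulr_natr -[k.+1 in leLHS]card_ord -sumr_const.
    by apply: ler_sum => l _; rewrite le_min !ge_min ca lexx orbT.
  + have [N rN] := ratio th2 theta_le1.
    (* [(C ^+ 2 / (C ^+ 2 + c))^-1 = 1 + c / C ^+ 2], at most the contraction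
       factor [1 + a k / C ^+ 2]: uncapped steps are compared directly. *)
    pose W k := (C ^+ 2 / (C ^+ 2 + c)) ^- k.
    have rho0 : 0 < C ^+ 2 / (C ^+ 2 + c) by rewrite divr_gt0 ?addr_gt0.
    apply: (@eqO_eventuallyS _ _ _ (r N * W N) N) => // k Nk.
    rewrite -ler_pdivrMr ?exprn_gt0//.
    apply: (@weighted_decay _ r (fun k => 1 + a k / C ^+ 2) W N)
      => // [l|l Nl|].
    * by rewrite invr_ge0 exprn_ge0// ltW.
    * rewrite /W exprS invfM ler_wpM2r ?invr_ge0 ?exprn_ge0 ?(ltW rho0)//.
      rewrite invf_div mulrDl divff ?gt_eqF// lerD2l.
      by rewrite ler_wpM2r ?invr_ge0 ?(ltW C2).
    * exact: leqW.
- move=> d d0 d1 ad.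
  have b01 k : (0 < k)%N -> 0 <= 1 / (k%:R : R) `^ d <= 1.
    move=> k0; have h : 1 <= (k%:R : R) `^ d.
      by rewrite -[leLHS](powRr0 k%:R) ler_powR ?ler1n// ltW.
    by rewrite divr_ge0 ?powR_ge0//= ler_pdivrMr ?mul1r//; apply: lt_le_trans h.
  split=> // [th2|th2 th1].
  + have [c [K [c0 K0 sK]]] := capped_sum_Omega a_ge0 b01 Cl0 ad.
    have -> : (fun k : nat =>
        (k%:R : R) `^ (- (1 + (2 * theta - d) / (1 - 2 * theta))))
        = (fun k => (k%:R `^ (1 - d)) `^ (- (1 - 2 * theta)^-1)).
      apply/funext => k; rewrite -powRrM; congr (_ `^ _); field; lra.
    apply: (@kl_decrease_pow_rate _ _ _ _ _ C_gt0 kl (c * 2^-1) (2 * K)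
      (fun k => k%:R `^ (1 - d))) => // [|k Kk].
    * by rewrite mulr_gt0.
    * apply: le_trans (sK k _); last by lia.
      rewrite -mulrA ler_pM2l//; apply: power_sum_ge => //; first exact: ltW.
      exact: leqW.
  + have [M [N [M0 rM]]] := exp_rate th2.
    apply: (exp_rate_liminf (ln3_gt1 R) Ce0 M0) rM _ => // k.
    * by apply: capped_sum_ge0 => //; apply: ltW.
    * exact: capped_sumS.
- move=> ad.
  have b01 k : (0 < k)%N -> 0 <= 1 / (k%:R : R) <= 1.
    by move=> k0; rewrite divr_ge0//= ler_pdivrMr ?mul1r ?ler1n ?ltr0n.
  have ln0 k : 0 <= ln (k%:R : R).
    by case: k => [|k]; [rewrite ln0|rewrite ln_ge0// ler1n].
  split=> // [th2|th2 th1].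
  + have [c [K [c0 K0 sK]]] := capped_sum_Omega a_ge0 b01 Cl0 ad.
    apply: (@kl_decrease_pow_rate _ _ _ _ _ C_gt0 kl (c * 2^-1) (K ^ 2)
      (fun k => ln k%:R)) => // [|k Kk|k Kk].
    * by rewrite mulr_gt0.
    * rewrite ln_gt0// ltr1n ltnS; apply: leq_trans Kk; by rewrite expn_gt0 K0.
    * apply: le_trans (sK k _); last first.
        by apply: leq_trans Kk; rewrite -{1}(expn1 K) leq_pexp2l.
      rewrite -mulrA ler_pM2l//; apply: harmonic_sum_ge => //.
      exact: leqW.
  + have [M [N [M0 rM]]] := exp_rate th2.
    apply: (exp_rate_liminf (ln3_gt1 R) Ce0 M0) rM _ => // [k|k|c k].
    * by apply: capped_sum_ge0 => //; apply: ltW.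
    * exact: capped_sumS.
    * by rewrite /powR pnatr_eq0.
Qed.
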